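(* Let $G_1$ be an $r_1$-regular graph with $r_1\ge 1$ on $n_1$ vertices and $m_1$ edges, and let $G_2$ be an $r_2$-regular graph with $r_2\ge1$ on $n_2$ vertices. Let $0=\mu_1,\mu_2,\ldots,\mu_{n_1}$ be the normalized Laplacian eigenvalues of $G_1$ and $0=\nu_1,\nu_2,\ldots,\nu_{n_2}$ those of $G_2$ (listed with multiplicity). Then the normalized Laplacian spectrum (as a multiset) of the subdivision-edge join $G_1\veebar G_2$ consists of: (i) $0$; (ii) $1$, with multiplicity $m_1-n_1$; (iii) $\dfrac{m_1+r_2\nu_i}{r_2+m_1}$ for $i=2,\ldots,n_2$; (iv) for each $i=2,\ldots,n_1$, the two roots of $(x-1)^2-\dfrac{2-\mu_i}{2+n_2}=0$; (v) the two roots of $x^2-\left(2+\dfrac{m_1}{r_2+m_1}\right)x+\dfrac{2m_1}{r_2+m_1}+\dfrac{n_2r_2}{(2+n_2)(r_2+m_1)}=0$. (If $m_1<n_1$, which can only happen when $r_1=1$, item (ii) means that $n_1-m_1$ copies of $1$ are removed from the multiset formed by items (i), (iii), (iv), (v).) Equivalently, the characteristic polynomial of $\mathcal{L}(G_1\veebar G_2)$ equals $$x(x-1)^{m_1-n_1}\left(x^2-\left(2+\tfrac{m_1}{r_2+m_1}\right)x+\tfrac{2m_1}{r_2+m_1}+\tfrac{n_2r_2}{(2+n_2)(r_2+m_1)}\right)\prod_{i=2}^{n_1}\left((x-1)^2-\tfrac{2-\mu_i}{2+n_2}\right)\prod_{i=2}^{n_2}\left(x-\tfrac{m_1+r_2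\nu_i}{r_2+m_1}\right).$$
   Context: All graphs are finite and simple. For a graph $G$ without isolated vertices, with adjacency matrix $A(G)$ and diagonal degree matrix $D(G)$, the normalized Laplacian matrix is $\mathcal{L}(G)=I-D(G)^{-1/2}A(G)D(G)^{-1/2}$; its eigenvalues (with multiplicity) form the normalized Laplacian spectrum of $G$. The subdivision graph $S(G)$ of $G$ is obtained by inserting a new vertex into every edge of $G$; the set of these new vertices is denoted $I(G)$. The subdivision-edge join $G_1\veebar G_2$ of graphs $G_1,G_2$ is the graph obtained from $S(G_1)$ and (a disjoint copy of) $G_2$ by joining each vertex of $I(G_1)$ with every vertex of $V(G_2)$. *)

(* Defs.v *)
From HB Require Import structures.
From mathcomp Require Import all_boot all_order all_algebra.
Set Implicit Arguments. Unset Strict Implicit. Unset Printing Implicit Defensive.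
Import Order.TTheory GRing.Theory Num.Theory.
Local Open Scope ring_scope.

Definition simple_graph (T : finType) (e : rel T) : Prop :=
  symmetric e /\ irreflexive e.

Definition deg (T : finType) (e : rel T) (v : T) : nat := #|[set u | e v u]|.

Definition regular (T : finType) (e : rel T) (r : nat) : Prop :=
  forall v, deg e v = r.

Definition adjmx (R : ringType) (T : finType) (e : rel T) : 'M[R]_#|T| :=
  \matrix_(i, j) (e (enum_val i) (enum_val j))%:R.

Definition invsqrt_degmx (R : rcfType) (T : finType) (e : rel T) : 'M[R]_#|T| :=
  diag_mx (\row_i (Num.sqrt ((deg e (enum_val i))%:R : R))^-1).

Definition nlap (R : rcfType) (T : finType) (e : rel T) : 'M[R]_#|T| :=
  1%:M - invsqrt_degmx R e *m adjmx R e *m invsqrt_degmx R e.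

Definition edge_set (T : finType) (e : rel T) : {set {set T}} :=
  [set s : {set T} | [exists x, exists y, e x y && (s == [set x; y])]].

Notation edgeT e := {s | s \in edge_set e}.

Definition sej_rel (T1 T2 : finType) (e1 : rel T1) (e2 : rel T2)
  : rel ((T1 + edgeT e1) + T2)%type :=
  fun a b =>
    match a, b with
    | inl (inl v), inl (inr s) => v \in val s
    | inl (inr s), inl (inl v) => v \in val s
    | inl (inr _), inr _ => true
    | inr _, inl (inr _) => true
    | inr w, inr w' => e2 w w'
    | _, _ => false
    end.
Arguments sej_rel {T1 T2} e1 e2 _ _.

(* Main.v *)
(** Put [y = x - 1].  Ordering the vertices as vertices of [G1], edges of [G1],
    vertices of [G2], the matrix [x I - L] is [[K, d z 1^T], [d 1 z^T, Q]], where
    [K = [[y I, c B], [c B^T, y I]]] with [B] the incidence matrix of [G1],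
    [Q = y I + A(G2) / (r2 + m1)] and [z] is the indicator of the edges.  By
    regularity the linear systems [K u = d z] and [Q v = 1] have solutions that are
    constant on each part, so this matrix is [diag(K, Q)] times a matrix
    with identity diagonal blocks and off-diagonal blocks of rank one.  Finally
    [det K * y ^ n1 = y ^ m1 * det (y^2 I - c^2 B B^T)] and [B B^T = r1 I + A(G1)].  The solutions [u] and [v] exist for all but finitely
    many [y], which is enough for an identity between polynomials. *)
Require Import Defs.
From HB Require Import structures.
From mathcomp Require Import all_boot all_order all_algebra.
From mathcomp Require Import fingroup perm ring lra.
Set Implicit Arguments. Unset Strict Implicit.
Import Order.TTheory GRing.Theory Num.Theory.
Local Open Scope ring_scope.

(** * Determinants of block matrices *)

Lemma det_block1_dr (R : comNzRingType) (m n : nat)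
    (A : 'M[R]_(m, n)) (B : 'M[R]_(n, m)) :
  \det (block_mx 1%:M A B 1%:M) = \det (1%:M - B *m A).
Proof.
have -> : block_mx 1%:M A B 1%:M =
    block_mx 1%:M 0 B 1%:M *m block_mx 1%:M A 0 (1%:M - B *m A).
  by rewrite mulmx_block !mul1mx !mul0mx !mulmx1 ?mulmx0 !addr0 addrC subrK.
by rewrite det_mulmx det_lblock det_ublock !det1 !mul1r.
Qed.

Lemma det_block1_ul (R : comNzRingType) (m n : nat)
    (A : 'M[R]_(m, n)) (B : 'M[R]_(n, m)) :
  \det (block_mx 1%:M A B 1%:M) = \det (1%:M - A *m B).
Proof.
have -> : block_mx 1%:M A B 1%:M =
    block_mx (1%:M - A *m B) A 0 1%:M *m block_mx 1%:M 0 B 1%:M.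
  by rewrite mulmx_block !mul1mx !mul0mx !mulmx1 ?mulmx0 ?add0r subrK.
by rewrite det_mulmx det_lblock det_ublock !det1 !mulr1.
Qed.

(** Eliminating either identity block of [block_mx 1%:M v w 1%:M] gives its determinant; one
    elimination leaves the n by n matrix, the other a 1 by 1 matrix. *)
Lemma det_1_sub_rank1 (R : comNzRingType) (n : nat) (v : 'cV[R]_n) (w : 'rV[R]_n) :
  \det (1%:M - v *m w) = 1 - (w *m v) 0 0.
Proof. by rewrite -det_block1_dr det_block1_ul det_mx11 !mxE. Qed.

(** Writing the off-diagonal blocks through [K *m u] and [Q *m v] lets diag(K, Q) be factored out
    without inverting [K] or [Q]. *)
Lemma det_block_rank1 (R : comNzRingType) (m n : nat) (K : 'M[R]_m) (Q : 'M[R]_n)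
    (u : 'cV[R]_m) (w : 'rV[R]_m) (v : 'cV[R]_n) (o : 'rV[R]_n) :
  \det (block_mx K (K *m u *m o) (Q *m v *m w) Q) =
  \det K * \det Q * (1 - (w *m u) 0 0 * (o *m v) 0 0).
Proof.
have -> : block_mx K (K *m u *m o) (Q *m v *m w) Q =
    block_mx K 0 0 Q *m block_mx 1%:M (u *m o) (v *m w) 1%:M.
  by rewrite mulmx_block !mulmx1 !mul0mx !addr0 !add0r !mulmxA.
rewrite det_mulmx det_lblock det_block1_dr -mulmxA det_1_sub_rank1.
by rewrite !mulmxA -mulmxA [w *m u]mx11_scalar mul_scalar_mx !mxE.
Qed.

(** A Schur complement free of division: the column operation with [- C] scales the first block
    column by [y], which costs the factor [y ^+ m]. *)
Lemma det_block_scalar (R : comNzRingType) (m n : nat) (y : R)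
    (B : 'M[R]_(m, n)) (C : 'M[R]_(n, m)) :
  \det (block_mx y%:M B C y%:M) * y ^+ m = y ^+ n * \det ((y ^+ 2)%:M - B *m C).
Proof.
have H : block_mx y%:M B C y%:M *m block_mx y%:M 0 (- C) 1%:M =
    block_mx ((y ^+ 2)%:M - B *m C) B 0 y%:M.
  rewrite mulmx_block !mulmx1 !mulmx0 !add0r !mulmxN -scalar_mxM -expr2.
  by rewrite mul_scalar_mx mul_mx_scalar subrr.
move/(congr1 determinant): H.
rewrite det_mulmx det_lblock det_ublock !det_scalar expr1n mulr1 => ->.
by rewrite mulrC.
Qed.

(** * Evaluating characteristic polynomials, reindexing, polynomial identities *)

Lemma horner_char_poly (R : comNzRingType) (n : nat) (A : 'M[R]_n) (x : R) :
  (char_poly A).[x] = \det (x%:M - A).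
Proof.
rewrite -horner_evalE /char_poly -det_map_mx; congr (\det _).
by apply/matrixP=> i j; rewrite !mxE /= horner_evalE hornerD hornerN hornerC hornerMn hornerX.
Qed.

Lemma det_affine_char_poly (F : fieldType) (n : nat) (A : 'M[F]_n) (s : nat -> F)
    (a b : F) :
  char_poly A = \prod_(i < n) ('X - (s i)%:P) -> b != 0 ->
  \det (a%:M + b *: A) = \prod_(i < n) (a + b * s i).
Proof.
move=> hA b0.
have -> : a%:M + b *: A = - b *: ((- (a / b))%:M - A).
  rewrite scalerBr scale_scalar_mx scaleNr opprK.
  by congr (_%:M + _); field.
rewrite detZ -horner_char_poly hA horner_prod.
under eq_bigr do rewrite !hornerE.
rewrite -[in _ ^+ n](card_ord n) -prodr_const -big_split /=.
by apply: eq_bigr => i _; field.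
Qed.

(** Two enumerations of [T] differ by a permutation, and conjugating by its matrix preserves the
    determinant. This allows the vertices of the join to be listed part by part. *)
Lemma det_reindex (R : comNzRingType) (T : finType) (m n : nat)
    (f : 'I_m -> T) (g : 'I_n -> T) (M : T -> T -> R) :
  bijective f -> bijective g ->
  \det (\matrix_(i, j) M (f i) (f j)) = \det (\matrix_(i, j) M (g i) (g j)).
Proof.
move=> bf bg; have mn : m = n.
  by rewrite -(card_ord m) -(card_ord n) (bij_eq_card bf) (bij_eq_card bg).
subst m; case: bg => g' gK g'K.
have inj : injective (g' \o f) by apply: inj_comp; [exact: can_inj g'K | exact: bij_inj].
pose s := perm inj.
have -> : \matrix_(i, j) M (f i) (f j) =
    perm_mx s *m (\matrix_(i, j) M (g i) (g j)) *m perm_mx s^-1.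
  rewrite -row_permE -col_permE; apply/matrixP=> i j.
  by rewrite !mxE !permE /= !g'K.
by rewrite !det_mulmx mulrAC -det_mulmx -perm_mxM mulgV perm_mx1 det1 mul1r.
Qed.

(** The product [(p - q) * h] vanishes everywhere; if nonzero, it would have more roots than its
    degree, for instance the first naturals, distinct in characteristic 0. *)
Lemma polyP_horner_generic (F : numFieldType) (p q h : {poly F}) : h != 0 ->
  (forall x, h.[x] != 0 -> p.[x] = q.[x]) -> p = q.
Proof.
move=> h0 H; apply/eqP; rewrite -subr_eq0; apply: contraT => pq0.
have d0 : (p - q) * h != 0 by rewrite mulf_neq0.
pose rs : seq F := [seq i%:R | i <- iota 0 (size ((p - q) * h))].
have := @max_poly_roots _ _ rs d0.
rewrite size_map size_iota ltnn; apply.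
  apply/allP=> x _; rewrite rootE !hornerE.
  by have [->|/H->] := eqVneq h.[x] 0; rewrite ?mulr0 // subrr mul0r.
by rewrite map_inj_uniq ?iota_uniq // => i j /eqP; rewrite eqr_nat => /eqP.
Qed.

(** * Counting incidences between vertices and edges *)

Lemma sum_indicator (R : nzRingType) (T : finType) (A : pred T) :
  \sum_(x : T) (A x)%:R = #|A|%:R :> R.
Proof. by rewrite -natr_sum -sum1_card [in RHS]big_mkcond. Qed.

Lemma card_edgeT (T : finType) (e : rel T) : #|{: edgeT e}| = #|edge_set e|.
Proof. by rewrite card_sig; apply: eq_card => s; rewrite inE. Qed.

Lemma degE (R : nzRingType) (T : finType) (e : rel T) (v : T) :
  (deg e v)%:R = \sum_u (e v u)%:R :> R.
Proof. by rewrite sum_indicator /deg cardsE. Qed.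

Lemma edge_setP (T : finType) (e : rel T) (s : {set T}) :
  reflect (exists x y, e x y /\ s = [set x; y]) (s \in edge_set e).
Proof.
rewrite inE; apply: (iffP existsP) => [[x /existsP[y /andP[? /eqP]]]|[x [y [exy ->]]]].
  by exists x, y.
by exists x; apply/existsP; exists y; rewrite exy eqxx.
Qed.

Lemma mem_edge_set2 (T : finType) (e : rel T) (x y : T) : symmetric e ->
  ([set x; y] \in edge_set e) = e x y.
Proof.
move=> sym; apply/edge_setP/idP => [[a [b [eab /setP E]]]|]; last by exists x, y.
(* These four memberships force the ordered pairs (a, b) and (x, y) to agree up to a swap, which
   symmetry absorbs. *)
have := E x; have := E y; have := E a; have := E b; rewrite !inE !eqxx !orbT /=.
by move=> /orP[] /eqP ? /orP[] /eqP ? /esym/orP[] /eqP ? /esym/orP[] /eqP ?;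
  subst; rewrite // sym.
Qed.

Lemma card_edge_set (T : finType) (e : rel T) (s : {set T}) : irreflexive e ->
  s \in edge_set e -> #|s| = 2.
Proof.
move=> irr /edge_setP[x [y [exy ->]]]; rewrite cards2.
by case: eqVneq exy => // ->; rewrite irr.
Qed.

(** The map sending a neighbour [u] to the edge {v, u} is a bijection onto the edges at [v];
    irreflexivity excludes [u = v] and gives injectivity. *)
Lemma card_incident (T : finType) (e : rel T) (v : T) : simple_graph e ->
  #|[set s in edge_set e | v \in s]| = deg e v.
Proof.
move=> [sym irr]; rewrite /deg.
have inj : {in [set u | e v u] &, injective (fun u => [set v; u])}.
  move=> u w; rewrite !inE => evu evw /setP /(_ u); rewrite !inE eqxx orbT.
  by case/esym/orP => /eqP // E; rewrite E irr in evu.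
rewrite -(card_in_imset inj); apply: eq_card => s; apply/idP/imsetP.
  rewrite in_set => /andP[].
  case/edge_setP=> [x [y [exy ->]]]; rewrite !inE => /orP[] /eqP->.
    by exists y; rewrite ?inE.
  by exists x; rewrite ?inE 1?sym // setUC.
case=> u; rewrite inE => evu ->; rewrite in_set mem_edge_set2 // evu.
by rewrite !inE eqxx.
Qed.

Lemma sum_incidence_edge (R : nzRingType) (T : finType) (e : rel T) (s : edgeT e) :
  simple_graph e -> \sum_v (v \in val s)%:R = 2 :> R.
Proof. by move=> [_ irr]; rewrite sum_indicator (card_edge_set irr (valP s)). Qed.

Lemma sum_incidence_vertex (R : nzRingType) (T : finType) (e : rel T) (v : T) :
  simple_graph e -> \sum_(s : edgeT e) (v \in val s)%:R = (deg e v)%:R :> R.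
Proof.
move=> G; rewrite -(big_sub (edge_set e) (fun s => (v \in s)%:R : R)).
rewrite -(card_incident v G) -natr_sum -big_mkcondr sum1_card.
by congr _%:R; apply: eq_card => s; rewrite in_set.
Qed.

(** These are the entries of B B^T: the only edge that can contain two distinct vertices [v] and [w]
    is {v, w} itself. *)
Lemma sum_incidence2 (R : nzRingType) (T : finType) (e : rel T) (v w : T) :
  simple_graph e ->
  \sum_(s : edgeT e) (v \in val s)%:R * (w \in val s)%:R =
  (deg e v)%:R *+ (v == w) + (e v w)%:R :> R.
Proof.
move=> G; case: (G) => sym irr; have [<-|vw] := eqVneq v w.
  rewrite irr addr0 mulr1n -sum_incidence_vertex //; apply: eq_bigr => s _.
  by case: (_ \in _); rewrite ?mulr1 ?mulr0.
rewrite mulr0n add0r.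
under eq_bigr do rewrite -natrM mulnb.
rewrite -(big_sub (edge_set e) (fun s => ((v \in s) && (w \in s))%:R : R)).
rewrite -natr_sum -big_mkcondr sum1_card; congr _%:R.
rewrite (eq_card (B := [pred s | (s == [set v; w]) && e v w])).
  case: (e v w).
    by rewrite -[RHS](card1 [set v; w]); apply: eq_card => s; rewrite !inE ?andbT.
  by apply: eq_card0 => s; rewrite !inE andbF.
move=> s; rewrite -!topredE /=.
apply/idP/idP; last first.
  by case/andP=> /eqP-> evw; rewrite mem_edge_set2 // evw !inE !eqxx orbT.
case/andP=> sE /andP[vs ws].
have E : s = [set v; w].
  apply/esym/eqP; rewrite eqEcard (card_edge_set irr sE) cards2 vw andbT.
  by apply/subsetP=> x; rewrite !inE => /orP[] /eqP->.
by move: sE; rewrite {1}E mem_edge_set2 // => ->; rewrite E eqxx.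
Qed.

(** * Block form of matrices indexed by a disjoint sum *)

(** Listing the left summand first matches the index convention of [block_mx], which the standard
    enumeration of the sum type need not do. *)
Definition sum_enum (m n : nat) (S T : Type) (f : 'I_m -> S) (g : 'I_n -> T)
    (i : 'I_(m + n)) : S + T :=
  match split i with inl k => inl (f k) | inr k => inr (g k) end.

Lemma sum_enum_bij (m n : nat) (S T : Type) (f : 'I_m -> S) (g : 'I_n -> T) :
  bijective f -> bijective g -> bijective (sum_enum f g).
Proof.
case=> f' fK f'K [g' gK g'K].
exists (fun x => unsplit (match x with inl a => inl (f' a) | inr b => inr (g' b) end)).
  move=> i; rewrite /sum_enum -[RHS]splitK.
  by case: (split i) => k; rewrite ?fK ?gK.
by case=> a; rewrite /sum_enum unsplitK ?f'K ?g'K.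
Qed.

Lemma matrix_sum_enum (R : Type) (m n : nat) (S T : Type)
    (f : 'I_m -> S) (g : 'I_n -> T) (M : S + T -> S + T -> R) :
  \matrix_(i, j) M (sum_enum f g i) (sum_enum f g j) =
  block_mx (\matrix_(i, j) M (inl (f i)) (inl (f j)))
           (\matrix_(i, j) M (inl (f i)) (inr (g j)))
           (\matrix_(i, j) M (inr (g i)) (inl (f j)))
           (\matrix_(i, j) M (inr (g i)) (inr (g j))).
Proof.
by apply/matrixP=> i j; rewrite !mxE /sum_enum;
  case: (split i) => ?; rewrite !mxE; case: (split j) => ?; rewrite !mxE.
Qed.

(** * The normalized Laplacian of a regular graph *)

Lemma nlapE (R : rcfType) (T : finType) (e : rel T) (i j : 'I_#|T|) :
  nlap R e i j = (i == j)%:R - (Num.sqrt (deg e (enum_val i))%:R)^-1 *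
    (e (enum_val i) (enum_val j))%:R * (Num.sqrt (deg e (enum_val j))%:R)^-1.
Proof. by rewrite /nlap /invsqrt_degmx mul_diag_mx mul_mx_diag !mxE. Qed.

Lemma invsqrt_mul (R : rcfType) (a : R) : 0 <= a ->
  (Num.sqrt a)^-1 * (Num.sqrt a)^-1 = a^-1.
Proof. by move=> a0; rewrite -invfM -expr2 sqr_sqrtr. Qed.

Lemma nlap_regular (R : rcfType) (T : finType) (e : rel T) (r : nat) :
  regular e r -> nlap R e = 1%:M - r%:R^-1 *: adjmx R e.
Proof.
move=> reg; apply/matrixP=> i j; rewrite nlapE !mxE !reg; congr (_ - _).
by rewrite mulrAC invsqrt_mul ?ler0n.
Qed.

Lemma adjmx_regular (R : rcfType) (T : finType) (e : rel T) (r : nat) :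
  regular e r -> (0 < r)%N -> adjmx R e = r%:R *: (1%:M - nlap R e).
Proof.
move=> reg r0; rewrite (nlap_regular R reg) opprB addrC subrK scalerA.
by rewrite divff ?scale1r // pnatr_eq0 -lt0n.
Qed.

(** * Degrees, incidence matrix and block form of the join *)

Section SubdivisionEdgeJoin.

Variables (R : rcfType) (T1 T2 : finType) (e1 : rel T1) (e2 : rel T2).
Hypothesis G1 : simple_graph e1.

Notation S := (sej_rel e1 e2).

Lemma deg_sej_vertex (v : T1) : (deg S (inl (inl v)))%:R = (deg e1 v)%:R :> R.
Proof.
rewrite degE !big_sumType /= -sum_incidence_vertex //.
by rewrite !big1_eq add0r addr0.
Qed.

Lemma deg_sej_edge (s : edgeT e1) : (deg S (inl (inr s)))%:R = 2 + #|T2|%:R :> R.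
Proof.
rewrite degE !big_sumType /= sum_incidence_edge // big1_eq addr0.
by rewrite sumr_const.
Qed.

Lemma deg_sej_join (w : T2) :
  (deg S (inr w))%:R = (deg e2 w)%:R + #|edge_set e1|%:R :> R.
Proof.
rewrite degE !big_sumType /= -degE big1_eq add0r sumr_const addrC.
by rewrite -[X in _ + X = _]/(#|{: edgeT e1}|%:R) card_edgeT.
Qed.

Definition incmx : 'M[R]_(#|T1|, #|{: edgeT e1}|) :=
  \matrix_(i, j) (enum_val i \in val (enum_val j : edgeT e1))%:R.

Lemma incmx_mul_tr (r : nat) : regular e1 r ->
  incmx *m incmx^T = r%:R%:M + adjmx R e1.
Proof.
move=> reg; apply/matrixP=> i j; rewrite !mxE.
under eq_bigr do rewrite !mxE.
rewrite -(big_enum_val (fun s : edgeT e1 =>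
  (enum_val i \in val s)%:R * (enum_val j \in val s)%:R : R)) /=.
by rewrite sum_incidence2 // reg (inj_eq enum_val_inj).
Qed.

Lemma incmx_const (r : nat) (a : R) : regular e1 r ->
  incmx *m const_mx a = const_mx (r%:R * a) :> 'cV_ _.
Proof.
move=> reg; apply/matrixP=> i j; rewrite !mxE.
under eq_bigr do rewrite !mxE.
rewrite -mulr_suml -(reg (enum_val i)) -sum_incidence_vertex //.
by rewrite [in RHS]big_enum_val.
Qed.

Lemma tr_incmx_const (a : R) : incmx^T *m const_mx a = const_mx (2 * a) :> 'cV_ _.
Proof.
apply/matrixP=> i j; rewrite !mxE.
under eq_bigr do rewrite !mxE.
rewrite -mulr_suml -(sum_incidence_edge R (enum_val i)) //.
by rewrite [in RHS]big_enum_val.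
Qed.

Lemma adjmx_const (r : nat) (a : R) : regular e2 r ->
  adjmx R e2 *m const_mx a = const_mx (r%:R * a) :> 'cV_ _.
Proof.
move=> reg; apply/matrixP=> i j; rewrite !mxE.
under eq_bigr do rewrite !mxE.
by rewrite -mulr_suml -(reg (enum_val i)) degE [in RHS]big_enum_val.
Qed.

(** The degrees in the join are [r1] on old vertices, 2 + n2 on edges and [k] on [G2]; [c] and [d]
    are the resulting weights of the two kinds of adjacency at an edge vertex. *)
Lemma det_sej (r1 r2 : nat) (x : R) : regular e1 r1 -> regular e2 r2 ->
  let k := r2%:R + #|edge_set e1|%:R in
  let c := (Num.sqrt r1%:R)^-1 * (Num.sqrt (2 + #|T2|%:R))^-1 in
  let d := (Num.sqrt (2 + #|T2|%:R))^-1 * (Num.sqrt k)^-1 in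
  \det (x%:M - nlap R S) =
  \det (block_mx (block_mx (x - 1)%:M (c *: incmx) (c *: incmx^T) (x - 1)%:M)
     (col_mx 0 (const_mx d)) (row_mx 0 (const_mx d))
     ((x - 1)%:M + k^-1 *: adjmx R e2)).
Proof.
move=> reg1 reg2 k c d.
(* The entries as a function of vertices, not of indices, so that [det_reindex] applies. *)
pose M a b := x *+ (a == b) - ((a == b)%:R -
  (Num.sqrt (deg S a)%:R)^-1 * (S a b)%:R * (Num.sqrt (deg S b)%:R)^-1).
have -> : x%:M - nlap R S = \matrix_(i, j) M (enum_val i) (enum_val j).
  by apply/matrixP=> i j; rewrite mxE [in RHS]mxE [X in _ + X]mxE nlapE mxE
    /M (inj_eq enum_val_inj).
pose f := sum_enum (sum_enum (@enum_val T1 T1) (@enum_val {: edgeT e1} {: edgeT e1}))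
  (@enum_val T2 T2).
have bf : bijective f by do 2?apply: sum_enum_bij; exact: enum_val_bij.
rewrite (det_reindex M (@enum_val_bij _) bf) /f matrix_sum_enum.
rewrite (matrix_sum_enum _ _ (fun a b => M (inl a) (inl b))).
have k0 : 0 <= k by rewrite addr_ge0 ?ler0n.
have Mvv v w : M (inl (inl v)) (inl (inl w)) = (x - 1) *+ (v == w).
  by rewrite /M mulr0 mul0r subr0 mulrnBl.
have Mvs v s : M (inl (inl v)) (inl (inr s)) = c * (v \in val s)%:R.
  by rewrite /M deg_sej_vertex deg_sej_edge reg1 mulr0n !sub0r opprK mulrAC.
have Msv v s : M (inl (inr s)) (inl (inl v)) = c * (v \in val s)%:R.
  by rewrite /M deg_sej_vertex deg_sej_edge reg1 mulr0n !sub0r opprK mulrAC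
    /c [X in X * _]mulrC.
have Mss s t : M (inl (inr s)) (inl (inr t)) = (x - 1) *+ (s == t).
  by rewrite /M mulr0 mul0r subr0 mulrnBl.
have Mvw v w : M (inl (inl v)) (inr w) = 0.
  by rewrite /M mulr0 mul0r !subr0.
have Mwv v w : M (inr w) (inl (inl v)) = 0.
  by rewrite /M mulr0 mul0r !subr0.
have Msw s w : M (inl (inr s)) (inr w) = d.
  by rewrite /M deg_sej_join deg_sej_edge reg2 mulr0n !sub0r opprK mulr1.
have Mws s w : M (inr w) (inl (inr s)) = d.
  by rewrite /M deg_sej_join deg_sej_edge reg2 mulr0n !sub0r opprK mulr1 mulrC.
have Mww w w' : M (inr w) (inr w') = (x - 1) *+ (w == w') + k^-1 * (e2 w w')%:R.
  by rewrite /M !deg_sej_join !reg2 mulrAC invsqrt_mul // opprB mulrnBl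
    addrCA addrC addrAC.
clearbody M.
congr (\det _); congr block_mx.
- by congr block_mx; apply/matrixP=> i j;
    rewrite !mxE ?(Mvv, Mvs, Msv, Mss) ?(inj_eq enum_val_inj).
- apply/matrixP=> i j; rewrite !mxE /sum_enum.
  by case: (split i) => a; rewrite !mxE ?(Mvw, Msw).
- apply/matrixP=> i j; rewrite !mxE /sum_enum.
  by case: (split j) => a; rewrite !mxE ?(Mwv, Mws).
- by apply/matrixP=> i j; rewrite !mxE Mww (inj_eq enum_val_inj).
Qed.

End SubdivisionEdgeJoin.

(** * The characteristic polynomial at a generic point *)

(** Here [q] is the eigenvalue of Q on constant vectors, and [p] is the value of y^2 - c^2 B B^T
    there. They are the denominators in the solutions [v] and [u]. *)
Lemma char_poly_sej_horner (R : rcfType) (T1 T2 : finType) (e1 : rel T1) (e2 : rel T2)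
    (r1 r2 : nat) (mu nu : nat -> R) (y : R) :
  simple_graph e1 -> regular e1 r1 -> regular e2 r2 -> (0 < r1)%N -> (0 < r2)%N ->
  char_poly (nlap R e1) = \prod_(i < #|T1|) ('X - (mu i)%:P) ->
  char_poly (nlap R e2) = \prod_(i < #|T2|) ('X - (nu i)%:P) ->
  let n2 := #|T2|%:R in let m1 := #|edge_set e1|%:R in
  let k := r2%:R + m1 in let t := (2 + n2)^-1 in
  let p := y ^+ 2 - 2 * t in let q := y + r2%:R / k in
  p != 0 -> q != 0 ->
  (char_poly (nlap R (sej_rel e1 e2))).[y + 1] * y ^+ #|T1| =
  y ^+ #|edge_set e1| * \prod_(i < #|T1|) (p + t * mu i) *
  \prod_(i < #|T2|) (q - r2%:R / k * nu i) *
  (1 - m1 * n2 * t * y / (k * p * q)).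
Proof.
move=> G1 reg1 reg2 r1_gt0 r2_gt0 char1 char2 n2 m1 k t p q p0 q0.
have r1_neq0 : r1%:R != 0 :> R by rewrite pnatr_eq0 -lt0n.
have r2_neq0 : r2%:R != 0 :> R by rewrite pnatr_eq0 -lt0n.
have n2_ge0 : 0 <= 2 + n2 by rewrite addr_ge0 ?ler0n.
have n2_neq0 : 2 + n2 != 0 by rewrite -natrD pnatr_eq0.
have k_ge0 : 0 <= k by rewrite addr_ge0 ?ler0n.
have k_neq0 : k != 0 by rewrite /k -natrD pnatr_eq0 addn_eq0 negb_and -lt0n r2_gt0.
rewrite horner_char_poly (det_sej G1 _ reg1 reg2) -/k addrK.
set c := _^-1 * _; set d := _^-1 * _.
have c2 : c ^+ 2 * r1%:R = t.
  rewrite exprMn !expr2 !invsqrt_mul ?ler0n // mulrAC mulVf //.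
  by rewrite mul1r.
have d2 : d ^+ 2 = t / k by rewrite exprMn !expr2 !invsqrt_mul.
set K := block_mx _ (c *: _) _ _; set Q := y%:M + _.
have Qone : Q *m const_mx q^-1 = const_mx 1 :> 'cV_ _.
  rewrite mulmxDl mul_scalar_mx -scalemxAl (adjmx_const _ reg2).
  by apply/matrixP=> i j; rewrite !mxE mulrA -mulrDl [_ * r2%:R]mulrC divff.
(* With constant parts a and b, K u = d z reads y a + c r1 b = 0 and 2 c a + y b = d; its
   determinant is y^2 - 2 c^2 r1 = p. *)
pose u : 'cV[R]_(#|T1| + #|{: edgeT e1}|) :=
  col_mx (const_mx (- (c * d * r1%:R) / p)) (const_mx (d * y / p)).
have Ku : K *m u = col_mx 0 (const_mx d).
  rewrite mul_block_col !mul_scalar_mx -!scalemxAl (incmx_const G1 _ reg1).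
  rewrite (tr_incmx_const G1); congr col_mx; apply/matrixP=> i j; rewrite !mxE.
    by field.
  have -> : c * (2 * (- (c * d * r1%:R) / p)) + y * (d * y / p) =
     d * (y ^+ 2 - 2 * (c ^+ 2 * r1%:R)) / p by field.
  by rewrite c2 mulfK.
have -> : col_mx 0 (const_mx d) = K *m u *m const_mx 1 :> 'M_(_, #|T2|).
  rewrite Ku mul_col_mx mul0mx; congr col_mx; apply/matrixP=> i j.
  by rewrite !mxE big_ord1 !mxE mulr1.
have -> : row_mx 0 (const_mx d) = Q *m (const_mx q^-1 : 'cV_ _) *m row_mx 0 (const_mx d)
    :> 'M_(_, #|T1| + #|{: edgeT e1}|).
  rewrite Qone mul_mx_row mulmx0; congr row_mx; apply/matrixP=> i j.
  by rewrite !mxE big_ord1 !mxE mul1r.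
rewrite det_block_rank1 mul_row_col mul0mx add0r.
have -> : ((const_mx d : 'rV_#|{: edgeT e1}|) *m (const_mx (d * y / p) : 'cV_ _)) 0 0 =
    m1 * d ^+ 2 * y / p.
  rewrite mxE; under eq_bigr do rewrite !mxE.
  rewrite sumr_const card_ord card_edgeT -mulr_natl -/m1.
  by field.
have -> : ((const_mx 1 : 'rV_#|T2|) *m (const_mx q^-1 : 'cV_ _)) 0 0 = n2 / q.
  rewrite mxE; under eq_bigr do rewrite !mxE.
  by rewrite sumr_const card_ord mul1r -mulr_natl.
have -> : \det Q = \prod_(i < #|T2|) (q - r2%:R / k * nu i).
  have -> : Q = q%:M + (- (r2%:R / k)) *: nlap R e2.
    rewrite /Q (adjmx_regular _ reg2) //; apply/matrixP=> i j; rewrite !mxE /q.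
    by case: (i == j); rewrite ?mulr1n ?mulr0n; ring.
  rewrite (det_affine_char_poly _ char2) ?oppr_eq0 ?mulf_neq0 ?invr_eq0 //.
  by apply: eq_bigr => i _; rewrite mulNr.
(* Since B B^T = r1 (2 I - L(G1)) and c^2 r1 = t, the matrix y^2 I - c^2 B B^T is p I + t L(G1). *)
have detK : \det K * y ^+ #|T1| =
    y ^+ #|edge_set e1| * \prod_(i < #|T1|) (p + t * mu i).
  rewrite det_block_scalar -card_edgeT; congr (_ * _).
  rewrite -scalemxAl -scalemxAr scalerA -expr2 (incmx_mul_tr _ G1 reg1).
  rewrite (adjmx_regular _ reg1) // -(det_affine_char_poly p char1) ?invr_eq0 //.
  congr (\det _); apply/matrixP=> i j; rewrite !mxE -c2 /p -c2.
  by case: (i == j); rewrite ?mulr1n ?mulr0n; ring.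
rewrite -detK d2; field.
by rewrite q0 p0 k_neq0.
Qed.

(** * From generic points to the polynomial identity *)

Unset Implicit Arguments.

Theorem theorem2p4 (R : rcfType) (T1 T2 : finType) (e1 : rel T1) (e2 : rel T2)
  (r1 r2 : nat) (mu nu : nat -> R) :
  simple_graph e1 -> simple_graph e2 ->
  regular e1 r1 -> regular e2 r2 -> (1 <= r1)%N -> (1 <= r2)%N ->
  (0 < #|T1|)%N -> (0 < #|T2|)%N ->
  char_poly (nlap R e1) = \prod_(i < #|T1|) ('X - (mu i)%:P) -> mu 0%N = 0 ->
  char_poly (nlap R e2) = \prod_(i < #|T2|) ('X - (nu i)%:P) -> nu 0%N = 0 ->
  let n1 := #|T1| in let n2 := #|T2| in let m1 := #|edge_set e1| in
  char_poly (nlap R (sej_rel e1 e2)) * ('X - 1) ^+ n1 =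
    'X * ('X - 1) ^+ m1 *
    ('X ^+ 2 - (2 + m1%:R / (r2%:R + m1%:R))%:P * 'X
      + (2 * m1%:R / (r2%:R + m1%:R)
         + (n2 * r2)%:R / ((2 + n2%:R) * (r2%:R + m1%:R)))%:P) *
    (\prod_(1 <= i < n1) (('X - 1) ^+ 2 - ((2 - mu i) / (2 + n2%:R))%:P)) *
    (\prod_(1 <= i < n2) ('X - ((m1%:R + r2%:R * nu i) / (r2%:R + m1%:R))%:P)).
Proof.
move=> G1 G2 reg1 reg2 r1_gt0 r2_gt0 T1_gt0 T2_gt0 char1 mu0 char2 nu0 n1 n2 m1.
set k : R := r2%:R + m1%:R.
have n2_neq0 : 2 + n2%:R != 0 :> R by rewrite -natrD pnatr_eq0.
have k_neq0 : k != 0 by rewrite /k -natrD pnatr_eq0 addn_eq0 negb_and -lt0n r2_gt0.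
pose p : {poly R} := ('X - 1%:P) ^+ 2 - (2 / (2 + n2%:R))%:P.
pose q : {poly R} := 'X - 1%:P + (r2%:R / k)%:P.
apply: (@polyP_horner_generic _ _ _ (p * q)).
  rewrite mulf_neq0 //; apply/eqP.
    (* Differences of values at two points cancel the constant terms, leaving a nonzero number. *)
    by move/(congr1 (fun f => f.[1] - f.[2])); rewrite !hornerE; lra.
  by move/(congr1 (fun f => f.[1] - f.[0])); rewrite !hornerE; lra.
move=> x; rewrite hornerM mulf_eq0 negb_or !hornerE => /andP[p0 q0].
have := @char_poly_sej_horner R T1 T2 e1 e2 r1 r2 mu nu (x - 1) G1 reg1 reg2
  r1_gt0 r2_gt0 char1 char2.
rewrite -/n1 -/n2 -/m1 -/k /= subrK => /(_ p0 q0).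
move=> ->; rewrite -/k !horner_prod.
(* With [k] opaque, this equation carries the link between [k], [r2] and [m1] into [field]. *)
have r2E : r2%:R = k - m1%:R by rewrite addrK.
clearbody k.
(* The factors of index 0, where [mu] and [nu] vanish, are exactly p and q; they are split off to
   join the rank-one correction. *)
rewrite -(big_mkord xpredT (fun i => _ + _ * mu i)).
rewrite -(big_mkord xpredT (fun i => _ - _ * nu i)).
rewrite (big_ltn T1_gt0) (big_ltn T2_gt0) mu0 nu0 !mulr0 addr0 subr0.
have -> : \prod_(1 <= i < n1) (('X - 1) ^+ 2 - ((2 - mu i) / (2 + n2%:R))%:P).[x] =
    \prod_(1 <= i < n1) ((x - 1) ^+ 2 - 2 / (2 + n2%:R) + (2 + n2%:R)^-1 * mu i).
  by apply: eq_bigr => i _; rewrite !hornerE; ring.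
have -> : \prod_(1 <= i < n2) ('X - ((m1%:R + r2%:R * nu i) / k)%:P).[x] =
    \prod_(1 <= i < n2) (x - 1 + r2%:R / k - r2%:R / k * nu i).
  by apply: eq_bigr => i _; rewrite !hornerE r2E; field.
set A := \prod_(_ <= _ < _) _; set B := \prod_(_ <= _ < _) _; set C := _ ^+ m1.
(* Clearing denominators leaves p q - m1 n2 t y / k. At x = 0 one has p = n2 t and q = - m1 / k, so
   this vanishes and x factors out. *)
have cubic : ((x - 1) ^+ 2 - 2 / (2 + n2%:R)) * (x - 1 + r2%:R / k) *
    (1 - m1%:R * n2%:R / (2 + n2%:R) * (x - 1) /
     (k * ((x - 1) ^+ 2 - 2 / (2 + n2%:R)) * (x - 1 + r2%:R / k))) =
    x * (x ^+ 2 - (2 + m1%:R / k) * x + 2 * m1%:R / k +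
     (n2 * r2)%:R / ((2 + n2%:R) * k)).
  rewrite mulrBr mulr1 (_ : _ * (_ / _) = m1%:R * n2%:R / (2 + n2%:R) * (x - 1) / k).
    by rewrite natrM r2E; field; rewrite k_neq0.
  move: p0 q0; set P := _ - _; set Q := _ + _ => p0 q0.
  by field; rewrite k_neq0 n2_neq0 q0 p0.
transitivity (C * A * B * (x * (x ^+ 2 - (2 + m1%:R / k) * x + 2 * m1%:R / k +
  (n2 * r2)%:R / ((2 + n2%:R) * k)))); last by ring.
by rewrite -cubic; ring.
Qed.
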